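(* Let $d,n\in\mathbb{N}$ with $d,n\geq 2$ and let $\mathbf{S}\subseteq\mathbf{T}$ be any heteroperturbative set of labeled spherical triangulations of unit spheres. Then the set $$\Pi_{d,n}(\mathbf{S}):=\left\{\mathrm{radii}(\mathfrak{p})\ :\ \mathfrak{p}\text{ a compact sphere packing of }\mathbb{R}^d,\ \mathfrak{p}\text{ is associated to }\mathbf{S},\ |\mathrm{radii}(\mathfrak{p})|=n,\ \max\mathrm{radii}(\mathfrak{p})=1\right\}$$ is finite.
   Context: **Sphere packings.** A sphere packing $\mathfrak{p}$ of $\mathbb{R}^d$ is a family of spheres in $\mathbb{R}^d$ with pairwise disjoint interiors (the interior of a sphere is the open ball it bounds). $\mathrm{radii}(\mathfrak{p})$ is the set of all radii of spheres in $\mathfrak{p}$. The contact hypergraph of $\mathfrak{p}$ has as vertex set the set of all centers of spheres in $\mathfrak{p}$; its hyperedges are exactly the (non-empty) subsets $E$ of the vertex set of cardinality at most $d+1$ such that (i) for every two distinct $a,b\in E$ the spheres of $\mathfrak{p}$ centered at $a$ and $b$ are mutually tangent, and (ii) any vertex of the hypergraph lying in the convex hull of $E$ is an element of $E$. The packing $\mathfrak{p}$ is compact if its contact hypergraph is exactly the vertex scheme (underlying abstract simplicial complex) of a homogeneous simplicial $d$-complex in $\mathbb{R}^d$ (homogeneous: every simplex is contained in a $d$-simplex of the complex) whose underlying space is homeomorphic to $\mathbb{R}^d$ through the identity map. This complex is called the packing complex of $\mathfrak{p}$. **Spherical triangulations.** Let $d\ge 2$, $1\le k\le d$. For a set $G\subseteq\mathbb{R}^d$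 of $k$ points with $0\notin G$ and $G\cup\{0\}$ affinely independent, the spherical $(k-1)$-simplex defined by $G$ is the central projection (from $0$) of the simplex with vertex set $G$ onto the unit sphere of $\mathbb{R}^d$ centered at $0$. A spherical simplicial complex is a simplicial complex except that all simplices are spherical simplices. A spherical triangulation of the unit sphere in $\mathbb{R}^d$ is a homogeneous spherical simplicial $(d-1)$-complex whose underlying space is homeomorphic to the unit sphere through the identity map. Lengths of edges are measured in the geodesic metric of the unit sphere. **Labeled triangulations and heteroperturbative sets.** $\mathbf{T}$ is the set of all labeled spherical triangulations of unit spheres of any finite dimension (in $\mathbb{R}^d$, any $d\geq 2$), where the center of the unit sphere (the origin) and all vertices carry labels from $\mathbb{N}\cup\{0\}$. $P,Q\in\mathbf{T}$ are combinatorially equivalent with identical labels if there is an isomorphism of their vertex schemes preserving vertex labels and their centers carry the same label; $[P]$ denotes the resulting equivalence class in $\mathbf{T}$. A set $\mathbf{S}\subseteq\mathbf{T}$ is heteroperturbative if for all $R\in\mathbf{S}$, all $P,Q\in[R]\cap\mathbf{S}$ and every label-preserving isomorphism between them (which makes edges of $P$ correspond to edges of $Q$): if $P$ and $Q$ are not edge-isometric (i.e. not every edge of $P$ has the same length as the corresponding edge of $Q$), then there is an edge of $P$ strictly longer than the corresponding edge of $Q$, and there is an edge of $P$ strictly shorter than the corresponding edge of $Q$. **Canonical triangulations.** Let $\mathfrak{p}$ be a compact sphere packing of $\mathbb{R}^d$ with $\mathrm{radii}(\mathfrak{p})=\{r_0<r_1<\dots<r_{n-1}\}$. The canonical labeling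 attaches label $j\in\{0,\dots,n-1\}$ to the center of each sphere of radius $r_j$. For a sphere $A\in\mathfrak{p}$, centrally project the link of the center of $A$ in the packing complex onto $A$, carrying vertex labels along (the center keeps its own label), and translate and scale to the unit sphere centered at $0$; the result is an element of $\mathbf{T}$ called the canonical labeled triangulation associated to $A$. The packing $\mathfrak{p}$ is associated to $\mathbf{S}$ if the canonical labeled triangulation associated to every sphere of $\mathfrak{p}$ is an element of $\mathbf{S}$. *)

(* Defs.v *)
From HB Require Import structures.
From mathcomp Require Import all_boot all_order all_algebra finmap.
From mathcomp Require Import all_classical all_reals all_analysis.

Set Implicit Arguments.
Unset Strict Implicit.
Unset Printing Implicit Defensive.

Import Order.TTheory GRing.Theory Num.Theory.
Import numFieldNormedType.Exports.

Local Open Scope classical_set_scope.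
Local Open Scope ring_scope.

(* R^d is 'rV[R]_d.  The library norm on 'rV[R]_d is the sup norm, so the
   Euclidean one is defined here; both induce the library topology. *)

Definition dotr (R : realType) (d : nat) (x y : 'rV[R]_d) : R :=
  \sum_(i < d) x 0 i * y 0 i.

Definition enorm (R : realType) (d : nat) (x : 'rV[R]_d) : R :=
  Num.sqrt (dotr x x).

Definition unit_sphere (R : realType) (d : nat) : set 'rV[R]_d :=
  [set x | enorm x = 1].

Definition normalize (R : realType) (d : nat) (x : 'rV[R]_d) : 'rV[R]_d :=
  (enorm x)^-1 *: x.

(* The hull of the empty set is empty. *)
Definition hull (R : realType) (d : nat) (E : {fset 'rV[R]_d}) :
    set 'rV[R]_d :=
  [set x | exists w : 'rV[R]_d -> R,
     [/\ forall v, v \in E -> 0 <= w v,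
         \sum_(v <- E) w v = 1
       & x = \sum_(v <- E) w v *: v]].

Definition affinely_independent (R : realType) (d : nat)
    (E : {fset 'rV[R]_d}) : Prop :=
  forall w : 'rV[R]_d -> R,
    \sum_(v <- E) w v = 0 -> \sum_(v <- E) w v *: v = 0 ->
    forall v, v \in E -> w v = 0.

(* A complex is given by its vertex scheme K, the set of the vertex sets of its
   simplices; [cell E] is the simplex with vertex set E.  The parameters [indep]
   and [cell] let the same definitions serve for straight and for spherical
   simplices. *)

(* The common face G of two simplices may be empty ([cell fset0 = set0]), in
   which case they are disjoint. *)
Definition simplicial_complex (R : realType) (d : nat)
    (indep : {fset 'rV[R]_d} -> Prop)
    (cell : {fset 'rV[R]_d} -> set 'rV[R]_d) (K : set {fset 'rV[R]_d}) : Prop :=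
  [/\ forall E, K E -> E != fset0 /\ indep E,
      forall E F : {fset 'rV[R]_d}, K E -> F != fset0 -> (F `<=` E)%fset -> K F
    & forall E F : {fset 'rV[R]_d}, K E -> K F ->
        exists G : {fset 'rV[R]_d},
          [/\ (G `<=` E)%fset, (G `<=` F)%fset
            & cell E `&` cell F = cell G]].

Definition homogeneous (R : realType) (d : nat) (m : nat)
    (K : set {fset 'rV[R]_d}) : Prop :=
  forall E, K E -> exists F : {fset 'rV[R]_d},
    [/\ K F, (E `<=` F)%fset & #|` F| = m.+1].

(* The underlying space carries the coherent topology: A is closed iff it meets
   every simplex in a relatively closed set.  For X closed (here R^d or the unit
   sphere) the identity is a homeomorphism from it to X iff the two conditions
   below hold; since X and the simplices are closed, relative closedness is
   closedness in R^d. *)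
Definition underlying_space_is (R : realType) (d : nat)
    (cell : {fset 'rV[R]_d} -> set 'rV[R]_d) (K : set {fset 'rV[R]_d})
    (X : set 'rV[R]_d) : Prop :=
  \bigcup_(E in K) cell E = X /\
  forall A : set 'rV[R]_d, A `<=` X ->
    (closed A <-> forall E, K E -> closed (A `&` cell E)).

Definition vertices (R : realType) (d : nat) (K : set {fset 'rV[R]_d}) :
    set 'rV[R]_d :=
  [set v | exists2 E, K E & v \in E].

Definition link (R : realType) (d : nat) (K : set {fset 'rV[R]_d})
    (a : 'rV[R]_d) : set {fset 'rV[R]_d} :=
  [set F | [/\ K F, a \notin F & K (a |` F)%fset]].

(* A sphere is the pair of its center and its radius. *)

Definition sphere_pts (R : realType) (d : nat) (A : 'rV[R]_d * R) :
    set 'rV[R]_d :=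
  [set x | enorm (x - A.1) = A.2].

Definition sphere_interior (R : realType) (d : nat) (A : 'rV[R]_d * R) :
    set 'rV[R]_d :=
  [set x | enorm (x - A.1) < A.2].

Definition tangent (R : realType) (d : nat) (A B : 'rV[R]_d * R) : Prop :=
  exists x, sphere_pts A `&` sphere_pts B = [set x].

Definition sphere_packing (R : realType) (d : nat) (p : set ('rV[R]_d * R)) :
    Prop :=
  (forall A, p A -> 0 < A.2) /\
  (forall A B, p A -> p B -> A <> B ->
     sphere_interior A `&` sphere_interior B = set0).

Definition radii (R : realType) (d : nat) (p : set ('rV[R]_d * R)) : set R :=
  [set A.2 | A in p].

Definition centers (R : realType) (d : nat) (p : set ('rV[R]_d * R)) :
    set 'rV[R]_d :=
  [set A.1 | A in p].

Definition contact_hypergraph (R : realType) (d : nat)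
    (p : set ('rV[R]_d * R)) : set {fset 'rV[R]_d} :=
  [set E | [/\ E != fset0,
               [set` E] `<=` centers p,
               (#|` E| <= d.+1)%N,
               forall A B, p A -> p B -> A.1 \in E -> B.1 \in E ->
                 A.1 != B.1 -> tangent A B
             & forall v, centers p v -> hull E v -> v \in E]].

Definition compact_packing (R : realType) (d : nat) (p : set ('rV[R]_d * R)) :
    Prop :=
  [/\ sphere_packing p,
      simplicial_complex (@affinely_independent R d) (@hull R d)
        (contact_hypergraph p),
      homogeneous d (contact_hypergraph p)
    & underlying_space_is (@hull R d) (contact_hypergraph p) setT].

(* A spherical simplex is given by its vertices on the unit sphere: central
   projection from 0 does not change when the points of G are moved along their
   rays, so G can be taken on the sphere. *)

Definition spherical_independent (R : realType) (d : nat)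
    (G : {fset 'rV[R]_d}) : Prop :=
  [/\ [set` G] `<=` @unit_sphere R d, 0 \notin G
    & affinely_independent ((0 : 'rV[R]_d) |` G)%fset].

Definition spherical_simplex (R : realType) (d : nat) (G : {fset 'rV[R]_d}) :
    set 'rV[R]_d :=
  [set normalize x | x in hull G].

Definition spherical_triangulation (R : realType) (d : nat)
    (K : set {fset 'rV[R]_d}) : Prop :=
  [/\ simplicial_complex (@spherical_independent R d) (@spherical_simplex R d) K,
      homogeneous d.-1 K
    & underlying_space_is (@spherical_simplex R d) K (@unit_sphere R d)].

Definition geodesic_length (R : realType) (d : nat) (u v : 'rV[R]_d) : R :=
  acos (dotr u v).

(* The labeling of the vertices is given by its graph, so that two labeled
   triangulations are equal as soon as they have the same simplices and the same
   labels (no value is attached to points that are not vertices). *)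
Record labeled_complex (R : realType) := LabeledComplex {
  lc_dim : nat;
  lc_simplices : set {fset 'rV[R]_lc_dim};
  lc_labels : set ('rV[R]_lc_dim * nat);
  lc_center_label : nat
}.

Definition labeled_triangulations (R : realType) : set (labeled_complex R) :=
  [set P | [/\ (2 <= lc_dim P)%N,
               spherical_triangulation (@lc_simplices R P),
               forall v l, lc_labels (v, l) -> vertices (@lc_simplices R P) v
             & forall v, vertices (@lc_simplices R P) v ->
                 exists! l, @lc_labels R P (v, l)]].

Definition scheme_isomorphism (R : realType) (d e : nat)
    (K : set {fset 'rV[R]_d}) (L : set {fset 'rV[R]_e})
    (phi : 'rV[R]_d -> 'rV[R]_e) : Prop :=
  set_bij (vertices K) (vertices L) phi /\
  forall E : {fset 'rV[R]_d}, [set` E] `<=` vertices K ->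
    (K E <-> L [fset phi v | v in E]%fset).

Definition label_isomorphism (R : realType) (P Q : labeled_complex R)
    (phi : 'rV[R]_(lc_dim P) -> 'rV[R]_(lc_dim Q)) : Prop :=
  scheme_isomorphism (@lc_simplices R P) (@lc_simplices R Q) phi /\
  forall v l, vertices (@lc_simplices R P) v ->
    (lc_labels (v, l) <-> lc_labels (phi v, l)).

Definition equivalent (R : realType) (P Q : labeled_complex R) : Prop :=
  (exists phi, @label_isomorphism R P Q phi) /\
  lc_center_label P = lc_center_label Q.

Definition eq_class (R : realType) (P : labeled_complex R) :
    set (labeled_complex R) :=
  [set Q | labeled_triangulations Q /\ equivalent P Q].

Definition edge (R : realType) (P : labeled_complex R)
    (u v : 'rV[R]_(lc_dim P)) : Prop :=
  u != v /\ lc_simplices [fset u; v]%fset.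

Definition edge_isometric (R : realType) (P Q : labeled_complex R)
    (phi : 'rV[R]_(lc_dim P) -> 'rV[R]_(lc_dim Q)) : Prop :=
  forall u v, edge u v -> geodesic_length u v = geodesic_length (phi u) (phi v).

Definition heteroperturbative (R : realType) (S : set (labeled_complex R)) :
    Prop :=
  forall P0, S P0 -> forall P Q, (eq_class P0 `&` S) P -> (eq_class P0 `&` S) Q ->
  forall phi, @label_isomorphism R P Q phi -> ~ edge_isometric phi ->
    (exists u v, edge u v /\
       geodesic_length (phi u) (phi v) < geodesic_length u v) /\
    (exists u v, edge u v /\
       geodesic_length u v < geodesic_length (phi u) (phi v)).

(* If radii p = {r_0 < ... < r_(n-1)}, this maps r_j to j; it is only meaningful
   for finite [radii p], as fset_set sends infinite sets to fset0. *)
Definition radius_label (R : realType) (d : nat) (p : set ('rV[R]_d * R))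
    (r : R) : nat :=
  index r (sort (fun x y : R => x <= y) (fset_set (radii p))).

(* Central projection from a onto the sphere with center a, followed by the
   translation and scaling to the unit sphere. *)
Definition project (R : realType) (d : nat) (a v : 'rV[R]_d) : 'rV[R]_d :=
  normalize (v - a).

Definition canonical_triangulation (R : realType) (d : nat)
    (p : set ('rV[R]_d * R)) (A : 'rV[R]_d * R) : labeled_complex R :=
  let L := link (contact_hypergraph p) A.1 in
  {| lc_dim := d;
     lc_simplices :=
       [set [fset project A.1 v | v in F]%fset | F in L];
     lc_labels :=
       [set (project A.1 B.1, radius_label p B.2)
          | B in [set B | p B /\ vertices L B.1]];
     lc_center_label := radius_label p A.2 |}.

Definition associated (R : realType) (d : nat) (p : set ('rV[R]_d * R))
    (S : set (labeled_complex R)) : Prop :=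
  forall A, p A -> S (canonical_triangulation p A).

Definition Pi_radii (R : realType) (d n : nat) (S : set (labeled_complex R)) :
    set (set R) :=
  [set radii p | p in
     [set p : set ('rV[R]_d * R) |
        [/\ compact_packing p, associated p S, (radii p #= `I_n)%card,
            radii p 1 & ubound (radii p) 1]]].

(* Main.v *)
(* Suppose there are infinitely many radii sets r_0 < ... < r_(n-1) = 1.  Along
   an infinite subfamily, for each label j the ratio r_j / r_0 is either bounded
   or tends to infinity; let I be the set of labels with bounded ratio.  Since
   R^d is connected, each packing has, for any proper nonempty set M of labels, a
   sphere labeled in M with a neighbor labeled outside M.  If M is contained in I,
   the neighbors of that sphere are seen from it in directions that are uniformly
   separated, so its canonical triangulation has finitely many types, and two
   packings p, q of the family, q late enough, share types for all these M.  Let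
   M be the set of labels i minimizing r_i(q) / r_i(p); it is contained in I.
   The cosine of the angle under which a sphere of radius a sees two tangent ones
   of radii b, c is 1 - 2 (b / (a + b)) (c / (a + c)), so from p to q no edge of
   the triangulation chosen for M gets shorter.  Heteroperturbativity then makes
   it edge-isometric, hence the ratio is also minimal at every neighbor, against
   the choice of the sphere.  So M contains all labels, and p, q have
   proportional, hence equal, radii. *)

Require Import Defs.
From mathcomp Require Import all_boot all_order all_algebra finmap.
From mathcomp Require Import all_classical all_reals all_analysis.
From mathcomp Require Import ring lra.

Set Implicit Arguments.
Unset Strict Implicit.
Unset Printing Implicit Defensive.

Import Order.TTheory GRing.Theory Num.Theory.
Import numFieldNormedType.Exports.

Local Open Scope classical_set_scope.
Local Open Scope ring_scope.

(** * Euclidean inner product and norm on row vectors *)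

Section Euclidean.
Variables (R : realType) (d : nat).
Implicit Types (x y z : 'rV[R]_d) (k : R).

Lemma dotrC x y : dotr x y = dotr y x.
Proof. by apply: eq_bigr => i _; rewrite mulrC. Qed.

Lemma dotrDl x y z : dotr (x + y) z = dotr x z + dotr y z.
Proof. by rewrite -big_split; apply: eq_bigr => i _; rewrite mxE mulrDl. Qed.

Lemma dotrZl k x y : dotr (k *: x) y = k * dotr x y.
Proof. by rewrite mulr_sumr; apply: eq_bigr => i _; rewrite mxE mulrA. Qed.

Lemma dotrNl x y : dotr (- x) y = - dotr x y.
Proof. by rewrite -scaleN1r dotrZl mulN1r. Qed.

Lemma dotrr_ge0 x : 0 <= dotr x x.
Proof. by apply: sumr_ge0 => i _; rewrite -expr2 sqr_ge0. Qed.

Lemma dotrBB x y : dotr (x - y) (x - y) = dotr x x - 2 * dotr x y + dotr y y.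
Proof.
rewrite dotrDl dotrNl ![dotr _ (x - y)]dotrC !dotrDl !dotrNl (dotrC y x).
by ring.
Qed.

Lemma enorm_ge0 x : 0 <= enorm x.
Proof. exact: sqrtr_ge0. Qed.

Lemma sqr_enorm x : enorm x ^+ 2 = dotr x x.
Proof. by rewrite sqr_sqrtr ?dotrr_ge0. Qed.

Lemma enormZ k x : enorm (k *: x) = `|k| * enorm x.
Proof.
by rewrite /enorm dotrZl dotrC dotrZl mulrA -expr2 sqrtrM ?sqr_ge0 // sqrtr_sqr.
Qed.

Lemma enormN x : enorm (- x) = enorm x.
Proof. by rewrite -scaleN1r enormZ normrN1 mul1r. Qed.

Lemma enorm_distC x y : enorm (x - y) = enorm (y - x).
Proof. by rewrite -enormN opprB. Qed.

Lemma enorm_eq0 x : enorm x = 0 -> x = 0.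
Proof.
move=> x0; have := sqr_enorm x; rewrite x0 expr0n /= => /esym/eqP.
rewrite psumr_eq0 => [/allP xE|i _]; last by rewrite -expr2 sqr_ge0.
apply/rowP => i; rewrite mxE; apply/eqP.
by have := xE i (mem_index_enum _); rewrite /= mulf_eq0 orbb.
Qed.

(** Cauchy-Schwarz: for nonzero vectors, expand the squared norm of [enorm y *: x - enorm x *: y],
    which is nonnegative. *)
Lemma dotr_le_enormM x y : dotr x y <= enorm x * enorm y.
Proof.
have d0 z : dotr 0 z = 0 by rewrite -(scale0r 0) dotrZl mul0r.
have [/enorm_eq0->|x0] := eqVneq (enorm x) 0.
  by rewrite d0 mulr_ge0 ?enorm_ge0.
have [/enorm_eq0->|y0] := eqVneq (enorm y) 0.
  by rewrite dotrC d0 mulr_ge0 ?enorm_ge0.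
have xy0 : 0 < enorm x * enorm y.
  by rewrite mulr_gt0 // lt_neqAle eq_sym enorm_ge0 ?x0 ?y0.
have := dotrr_ge0 (enorm y *: x - enorm x *: y).
rewrite dotrBB !dotrZl !(dotrC _ (_ *: _)) !dotrZl -!sqr_enorm (dotrC y x).
by move=> h; rewrite -subr_ge0 -(pmulr_rge0 _ xy0); nra.
Qed.

Lemma enormD x y : enorm (x + y) <= enorm x + enorm y.
Proof.
rewrite -(@ler_pXn2r _ 2) // ?nnegrE ?addr_ge0 ?enorm_ge0 // sqrrD !sqr_enorm.
rewrite dotrDl !(dotrC _ (x + y)) !dotrDl (dotrC y x).
by have := dotr_le_enormM x y; lra.
Qed.

Lemma dotr_unit_normalize x : enorm x != 0 -> dotr (normalize x) (normalize x) = 1.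
Proof.
move=> x0; rewrite -sqr_enorm enormZ normfV ger0_norm ?enorm_ge0 //.
by rewrite mulVf // expr1n.
Qed.

End Euclidean.

(** * Distances and contact angles in a packing *)

Section Spheres.
Variables (R : realType) (d : nat).
Implicit Types (A B C : 'rV[R]_d * R).

Lemma packing_center_inj (p : set ('rV[R]_d * R)) A B :
  sphere_packing p -> p A -> p B -> A.1 = B.1 -> A = B.
Proof.
move=> [pos dis] pA pB AB; apply: contrapT => nAB.
have : (sphere_interior A `&` sphere_interior B) A.1.
  have e0 : enorm (0 : 'rV[R]_d) = 0 by rewrite -(scale0r 0) enormZ normr0 mul0r.
  by split; rewrite /sphere_interior /= -?AB subrr e0 pos.
by rewrite dis.
Qed.

(** Otherwise the point dividing the segment of centers in the ratio of the radii would lie in both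
    open balls. *)
Lemma packing_dist_ge (p : set ('rV[R]_d * R)) A B :
  sphere_packing p -> p A -> p B -> A.1 != B.1 ->
  A.2 + B.2 <= enorm (B.1 - A.1).
Proof.
move=> [pos dis] pA pB AB; rewrite leNgt; apply/negP => lt_dist.
have A0 := pos _ pA; have B0 := pos _ pB.
have AB0 : 0 < A.2 + B.2 by rewrite addr_gt0.
pose t := A.2 / (A.2 + B.2).
have t0 : 0 < t by rewrite divr_gt0.
have t1 : 1 - t = B.2 / (A.2 + B.2) by rewrite /t; field; rewrite gt_eqF.
suff : (sphere_interior A `&` sphere_interior B) (A.1 + t *: (B.1 - A.1)).
  by rewrite dis // => AB'; rewrite AB' eqxx in AB.
split; rewrite /sphere_interior /=.
  rewrite addrAC subrr add0r enormZ gtr0_norm //.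
  by rewrite /t mulrAC ltr_pdivrMr // ltr_pM2l.
have -> : A.1 + t *: (B.1 - A.1) - B.1 = (1 - t) *: (A.1 - B.1).
  by rewrite scalerBl scale1r addrAC -scalerN opprB.
rewrite enormZ enorm_distC t1 gtr0_norm ?divr_gt0 //.
by rewrite mulrAC ltr_pdivrMr // ltr_pM2l.
Qed.

(** The contact point bounds the distance from above by the triangle inequality; disjoint interiors
    bound it from below, which excludes internal tangency. *)
Lemma tangent_dist (p : set ('rV[R]_d * R)) A B :
  sphere_packing p -> p A -> p B -> A.1 != B.1 -> tangent A B ->
  enorm (B.1 - A.1) = A.2 + B.2.
Proof.
move=> pP pA pB AB [x xE].
apply/eqP; rewrite eq_le (packing_dist_ge pP) // andbT.
have [xA xB] : (sphere_pts A `&` sphere_pts B) x by rewrite xE.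
rewrite -xA -xB (enorm_distC _ A.1) (enorm_distC x).
by have := enormD (A.1 - x) (x - B.1); rewrite addrA subrK.
Qed.

(* By the law of cosines, the angle at a sphere of radius [a] tangent to spheres
   of radii [b], [c] that are tangent to each other has cosine
   [cos_contact a b c]. *)
Definition share (a b : R) : R := b / (a + b).
Definition cos_contact (a b c : R) : R := 1 - 2 * (share a b * share a c).

Lemma share_gt0 a b : 0 < a -> 0 < b -> 0 < share a b.
Proof. by move=> a0 b0; rewrite divr_gt0 ?addr_gt0. Qed.

Lemma share_lt1 a b : 0 < a -> 0 < b -> share a b < 1.
Proof. by move=> a0 b0; rewrite ltr_pdivrMr ?addr_gt0 // mul1r ltrDr. Qed.

(** [share a b] is an increasing function of the ratio [b / a] alone; the ratios are compared here
    after cross-multiplication. *)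
Lemma ler_share a b a' b' : 0 < a -> 0 < b -> 0 < a' -> 0 < b' ->
  (share a b <= share a' b') = (a' * b <= a * b').
Proof.
move=> a0 b0 a0' b0'; rewrite ler_pdivrMr ?addr_gt0 // mulrAC.
by rewrite ler_pdivlMr ?addr_gt0 // !mulrDr (mulrC b b') lerD2r (mulrC b) (mulrC b').
Qed.

Lemma cos_contact_itv a b c : 0 < a -> 0 < b -> 0 < c ->
  -1 < cos_contact a b c < 1.
Proof.
move=> a0 b0 c0; rewrite /cos_contact.
have := share_gt0 a0 b0; have := share_gt0 a0 c0.
by have := share_lt1 a0 b0; have := share_lt1 a0 c0 => *; apply/andP; split; nra.
Qed.

(** Law of cosines. The correction term vanishes when the spheres around [y] and [z] touch, which
    gives exact edge lengths, and is nonpositive when their interiors are disjoint, which separates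
    the directions of any two neighbors. *)
Lemma dotr_project (a b c : R) (x y z : 'rV[R]_d) : 0 < a -> 0 < b -> 0 < c ->
  enorm (y - x) = a + b -> enorm (z - x) = a + c ->
  dotr (project x y) (project x z) =
  cos_contact a b c + ((b + c) ^+ 2 - enorm (z - y) ^+ 2) / (2 * (a + b) * (a + c)).
Proof.
move=> a0 b0 c0 yx zx.
have := dotrBB (z - x) (y - x); rewrite opprB addrA subrK -!sqr_enorm yx zx => ->.
rewrite /project /normalize yx zx dotrZl dotrC dotrZl /cos_contact /share.
by field; rewrite !gt_eqF ?addr_gt0.
Qed.
End Spheres.

(** * A finite partition separating directions *)

Section Grid.
Variables (R : realType) (d : nat).
Implicit Types (x y : 'rV[R]_d).

Lemma sqr_coord_le x i : x 0 i ^+ 2 <= dotr x x.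
Proof.
rewrite /dotr (bigD1 i) //= -expr2 lerDl.
by apply: sumr_ge0 => j _; rewrite -expr2 sqr_ge0.
Qed.

(** [g] records the cube of side [1 / K] containing the vector. Two unit vectors in one cube have
    squared distance at most [d / K < delta], whereas [dotr x y <= 1 - delta] makes it at least
    [2 * delta]. *)
Lemma separating_grid (delta : R) : 0 < delta ->
  exists (G : finType) (g : 'rV[R]_d -> G), forall x y,
    enorm x = 1 -> enorm y = 1 -> dotr x y <= 1 - delta -> g x != g y.
Proof.
move=> delta0; pose K := (Num.trunc (d%:R / delta)).+1.
have K0 : 0 < K%:R :> R by rewrite ltr0n.
have K1 : 1 <= K%:R :> R by rewrite ler1n.
have dK : d%:R < delta * K%:R.
  rewrite mulrC -ltr_pdivrMr //.
  by have /andP[] := truncn_itv (divr_ge0 (ler0n R d) (ltW delta0)).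
pose h x i := (x 0 i + 1) * K%:R.
(* The coordinate 1 falls into the cell of index [2 * K], hence the successor. *)
exists {ffun 'I_d -> 'I_(2 * K).+1}.
exists (fun x => [ffun i => inord (Num.trunc (h x i))]).
move=> x y; have unit_coord z i : enorm z = 1 -> 0 <= h z i <= 2 * K%:R.
  move=> z1; have := sqr_coord_le z i; rewrite -sqr_enorm z1 expr1n => zi.
  have /andP[zi1 zi2] : -1 <= z 0 i <= 1 by apply/andP; split; nra.
  by rewrite /h; apply/andP; split; [rewrite mulr_ge0 //|rewrite ler_wpM2r //]; lra.
move=> x1 y1 xy; apply/eqP => /ffunP exy.
have close i : (x 0 i - y 0 i) * (x 0 i - y 0 i) <= (K%:R)^-1.
  have /andP[hx0 hx2] := unit_coord x i x1; have /andP[hy0 hy2] := unit_coord y i y1.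
  have small z : 0 <= z -> z <= 2 * K%:R :> R -> (Num.trunc z < (2 * K).+1)%N.
    by move=> z0 z2; rewrite truncn_lt_nat // -natr1 natrM; lra.
  have := exy i; rewrite !ffunE => /(congr1 val) /=.
  rewrite !inordK ?small // => trE.
  have /andP[] := truncn_itv hx0; have /andP[] := truncn_itv hy0.
  rewrite trE -natr1 => ? ? ? ?.
  have : (h x i - h y i) ^+ 2 <= 1 by nra.
  have -> : h x i - h y i = (x 0 i - y 0 i) * K%:R by rewrite /h; ring.
  rewrite -expr2 exprMn => le1; rewrite -[X in _ <= X]mul1r ler_pdivlMr //.
  apply: le_trans le1; rewrite ler_wpM2l ?sqr_ge0 // expr2.
  by rewrite -[X in X <= _]mulr1 ler_pM2l.
have : dotr (x - y) (x - y) <= d%:R / K%:R.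
  rewrite -[d in d%:R]card_ord -sumr_const mulr_suml; apply: ler_sum => i _.
  by rewrite !mxE mul1r close.
rewrite dotrBB -!sqr_enorm x1 y1 ler_pdivlMr // => le_dK.
have : delta * K%:R <= (1 - dotr x y) * K%:R by rewrite ler_pM2r //; lra.
nra.
Qed.

End Grid.

(** * Crossing edges from the connectedness of space *)

Section Connectivity.
Variables (R : realType) (d : nat) (p : set ('rV[R]_d * R)).
Hypothesis cp : compact_packing p.
Let K := contact_hypergraph p.

Lemma contact_closed (E F : {fset 'rV[R]_d}) :
  K E -> F != fset0 -> (F `<=` E)%fset -> K F.
Proof. by case: cp => _ [_ + _ _ _]; apply. Qed.

(** If [Y] had a point [b], the preimages of [X] and [Y] along the line through [a] and [b] would
    disconnect the real line. *)
Lemma clopen_rV (X Y : set 'rV[R]_d) :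
  closed X -> closed Y -> X `|` Y = setT -> X `&` Y = set0 ->
  X !=set0 -> Y = set0.
Proof.
move=> clX clY XY XY0 [a Xa]; apply: contrapT => /eqP /set0P[b Yb].
pose f (t : R) := a + t *: (b - a).
have cf : continuous f.
  by move=> t; apply: cvgD; [exact: cvg_cst|apply: cvgZr_tmp; exact: cvg_id].
have clp Z : closed Z -> closed (f @^-1` Z).
  by apply: preimage_closed => ? _; exact: cf.
have co : connected [set: R] by apply/connected_intervalP.
have /= fX : [set: R] = f @^-1` X.
  apply/esym/co.
  - by exists 0; rewrite /f /= scale0r addr0.
  - exists (~` (f @^-1` Y)); first by apply: closed_openC; apply: clp.
    rewrite setTI; apply/seteqP; split=> t /= ft.
      by move=> Yt; have : (X `&` Y) (f t) by []; rewrite XY0.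
    by have [] : (X `|` Y) (f t) by rewrite XY.
  - by exists (f @^-1` X); rewrite ?setTI //; exact: clp.
have : (X `&` Y) b.
  split=> //; have : [set: R] 1 by []. 
  by rewrite fX /f /= scale1r addrC subrK.
by rewrite XY0.
Qed.

Lemma hull0 : hull (fset0 : {fset 'rV[R]_d}) = set0.
Proof.
apply/seteqP; split=> // x [w [_ + _]]; rewrite big_seq_fset0 => /esym/eqP.
by rewrite oner_eq0.
Qed.

Definition side (M : set R) : set {fset 'rV[R]_d} :=
  [set E | K E /\ exists A, [/\ p A, M A.2 & A.1 \in E]].

(** By the coherent topology, closedness is tested cell by cell, and each cell is either contained
    in the union or disjoint from it. *)
Lemma closed_side (M N : set R) :
  (forall E, K E -> side M E \/ side N E) ->
  (\bigcup_(E in side M) hull E) `&` (\bigcup_(E in side N) hull E) = set0 ->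
  closed (\bigcup_(E in side M) hull E).
Proof.
have [_ _ _ [_ coh]] := cp; move=> MN dis; apply/(coh _ (@subsetT _ _)) => E KE.
case: (MN _ KE) => sE; last first.
  rewrite (_ : _ `&` _ = set0); first exact: closed0.
  by apply: subsetI_eq0 dis => // x Ex; exists E.
rewrite setIidr; last by move=> x Ex; exists E.
rewrite -(setTI (hull E)).
(* That a cell is itself closed follows from coherence applied to the whole space. *)
by have /(coh _ (@subsetT _ _)) := @closedT 'rV[R]_d; apply.
Qed.

(* The cells meeting [M] and those meeting its complement would otherwise
   split R^d into two disjoint closed sets. *)
Lemma contact_crossing (M : set R) :
  radii p `&` M !=set0 -> radii p `&` ~` M !=set0 ->
  exists A B, [/\ p A, p B, M A.2, ~ M B.2 & K [fset A.1; B.1]%fset].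
Proof.
move=> [r [[A pA <-] MA]] [_ [[B pB <-] MB]].
have [_ [sc _ face] _ [cover _]] := cp.
have cell_center N D : p D -> N D.2 -> (\bigcup_(E in side N) hull E) D.1.
  move=> pD ND; have : [set: 'rV[R]_d] D.1 by [].
  rewrite -cover => -[E KE ED]; exists E => //; split=> //; exists D.
  by split=> //; case: KE => _ _ _ _; apply=> //; exists D.
have sideP E v : K E -> v \in E -> exists2 D, p D & D.1 = v.
  by move=> [_ Ep _ _ _] vE; have [D pD <-] := Ep v vE; exists D.
have total E : K E -> side M E \/ side (~` M) E.
  move=> KE; have [/fset0Pn[v vE] _] := sc _ KE.
  have [D pD Dv] := sideP _ _ KE vE; rewrite -Dv in vE.
  by have [MD|MD] := pselect (M D.2); [left|right]; split=> //; exists D.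
apply: contrapT => none.
(* A cell with vertices of both kinds would have a crossing edge as a face. *)
have nmix E : side M E -> side (~` M) E -> False.
  move=> [KE [A' [pA' MA' EA']]] [_ [B' [pB' MB' EB']]].
  apply: none; exists A', B'; split=> //.
  apply: contact_closed KE _ _.
    by apply/fset0Pn; exists A'.1; rewrite !inE eqxx.
  by apply/fsubsetP => v; rewrite !inE => /orP[]/eqP->.
(* A point common to two cells lies in a common face, any vertex of which makes one of the two cells
   mixed. *)
have dis : (\bigcup_(E in side M) hull E) `&`
           (\bigcup_(E in side (~` M)) hull E) = set0.
  apply/seteqP; split=> // x [[E ME Ex] [F NF Fx]].
  have [G [GE GF EFG]] := face _ _ ME.1 NF.1.
  have : hull G x by rewrite -EFG.
  have [->|/fset0Pn[v vG] _] := eqVneq G fset0; first by rewrite hull0.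
  have [D pD Dv] := sideP _ _ ME.1 (fsubsetP GE _ vG); rewrite -Dv in vG.
  have [MD|MD] := pselect (M D.2).
    by apply: (nmix F) => //; split;
       [exact: NF.1|exists D; split; rewrite ?(fsubsetP GF)].
  by apply: (nmix E) => //; split;
     [exact: ME.1|exists D; split; rewrite ?(fsubsetP GE)].
have : (\bigcup_(E in side (~` M)) hull E) B.1 by exact: cell_center.
rewrite (@clopen_rV (\bigcup_(E in side M) hull E)
                    (\bigcup_(E in side (~` M)) hull E)) //.
- exact: closed_side dis.
- by apply: (@closed_side _ M); [move=> E /total; tauto|rewrite setIC].
- apply/seteqP; split=> // x _; have : [set: 'rV[R]_d] x by [].
  by rewrite -cover => -[E KE Ex]; case: (total _ KE) => ?; [left|right]; exists E.
- by exists A.1; exact: cell_center.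
Qed.

End Connectivity.

(** * Finite codes of labeled complexes *)

Section ComplexCode.
Variables (R : realType) (d n : nat) (G : finType) (g : 'rV[R]_d -> G).
Implicit Types (K : set {fset 'rV[R]_d}) (lab : set ('rV[R]_d * nat)).
Implicit Types (E F : {fset 'rV[R]_d}).

Definition gimage E : {set G} := [set x in [seq g v | v <- E]].

(** Vertices are replaced by their images under [g], so that the codes range over a finite type;
    they determine the labeled complex up to isomorphism once [g] is injective on the vertices and
    the labels are below [n]. *)
Definition scheme_code K : {set {set G}} :=
  [set X | `[< exists2 E, K E & X = gimage E >]].

Definition label_code K lab : {set G * 'I_n} :=
  [set x | `[< exists v, [/\ vertices K v, x.1 = g v & lab (v, val x.2)] >]].

Lemma gimageP E x : reflect (exists2 v, v \in E & x = g v) (x \in gimage E).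
Proof. by rewrite inE; exact: mapP. Qed.

Lemma vertices_sub K E : K E -> [set` E] `<=` vertices K.
Proof. by move=> KE v vE; exists E. Qed.

Section Injective.
Variable K : set {fset 'rV[R]_d}.
Hypothesis g_inj : set_inj (vertices K) g.

Let g_injE u v : vertices K u -> vertices K v -> g u = g v -> u = v.
Proof. by move=> Ku Kv; apply: g_inj; rewrite inE. Qed.

Lemma gimage_inj E F : [set` E] `<=` vertices K -> [set` F] `<=` vertices K ->
  gimage E = gimage F -> E = F.
Proof.
move=> EK FK EF; apply/fsetP => v; apply/idP/idP => v_in.
  have /gimageP[w wF /g_injE->//] : g v \in gimage F.
  - by rewrite -EF; apply/gimageP; exists v.
  - exact: EK.
  - exact: FK.
have /gimageP[w wE /g_injE->//] : g v \in gimage E.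
- by rewrite EF; apply/gimageP; exists v.
- exact: FK.
- exact: EK.
Qed.

Lemma scheme_codeP E : [set` E] `<=` vertices K ->
  K E <-> gimage E \in scheme_code K.
Proof.
move=> EK; rewrite inE; split=> [KE|/asboolP[F KF EF]].
  by apply/asboolP; exists E.
by rewrite (gimage_inj EK (vertices_sub KF) EF).
Qed.

Lemma label_codeP lab v (l : 'I_n) : vertices K v ->
  lab (v, val l) <-> (g v, l) \in label_code K lab.
Proof.
move=> Kv; rewrite inE; split=> [vl|/asboolP[w /= [Kw /g_injE->//]]].
by apply/asboolP; exists v.
Qed.

End Injective.

Lemma scheme_code_vertex K K' u : scheme_code K = scheme_code K' ->
  vertices K u -> exists v, vertices K' v /\ g v = g u.
Proof.
move=> KK' [E KE uE].
have : gimage E \in scheme_code K by rewrite inE; apply/asboolP; exists E.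
rewrite KK' inE => /asboolP[F KF EF].
have : g u \in gimage E by apply/gimageP; exists u.
by rewrite EF => /gimageP[v vF uv]; exists v; split=> //; exists F.
Qed.

(** The isomorphism matches the vertices of [K] and [K'] that have the same image under [g]. *)
Lemma code_isomorphism K K' lab lab' :
  set_inj (vertices K) g -> set_inj (vertices K') g ->
  (forall v l, lab (v, l) -> (l < n)%N) ->
  (forall v l, lab' (v, l) -> (l < n)%N) ->
  scheme_code K = scheme_code K' -> label_code K lab = label_code K' lab' ->
  exists phi, scheme_isomorphism K K' phi /\
    forall v l, vertices K v -> (lab (v, l) <-> lab' (phi v, l)).
Proof.
move=> gK gK' labn labn' KK' ll'.
(* The default value [v] is only taken outside the vertices of [K], since equal codes provide a
   match for each vertex. *)
pose phi v := xget v [set w | vertices K' w /\ g w = g v].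
have phiP v : vertices K v -> vertices K' (phi v) /\ g (phi v) = g v.
  by move=> /(scheme_code_vertex KK')/xgetPex-/(_ v).
exists phi; split; first split; first split.
- by move=> v /phiP[].
- move=> u v; rewrite !inE => Ku Kv /(congr1 g).
  by rewrite (phiP _ Ku).2 (phiP _ Kv).2; apply: gK; rewrite inE.
- move=> w Kw; have [v [Kv vw]] := scheme_code_vertex (esym KK') Kw.
  exists v => //; apply: gK'; rewrite ?inE //; first exact: (phiP _ Kv).1.
  by rewrite (phiP _ Kv).2.
- move=> E EK; rewrite (scheme_codeP gK EK).
  have phiE : [set` [fset phi v | v in E]%fset] `<=` vertices K'.
    by move=> _ /= /imfsetP[v /= vE ->]; exact: (phiP _ (EK _ vE)).1.
  rewrite (scheme_codeP gK' phiE) KK'.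
  suff -> : gimage E = gimage [fset phi v | v in E]%fset by [].
  apply/setP => x; apply/gimageP/gimageP => -[v].
    move=> vE ->; exists (phi v); first by apply/imfsetP; exists v.
    by rewrite (phiP _ (EK _ vE)).2.
  by move=> /imfsetP[w /= wE ->] ->; exists w => //; exact: (phiP _ (EK _ wE)).2.
- move=> v l Kv; have [Kv' gv] := phiP _ Kv.
  split=> vl.
    have ln := labn _ _ vl; move: vl.
    rewrite -[l]/(val (Ordinal ln)) (label_codeP gK) // ll' -gv.
    by rewrite -(label_codeP gK').
  have ln := labn' _ _ vl; move: vl.
  rewrite -[l]/(val (Ordinal ln)) (label_codeP gK') // -ll' gv.
  by rewrite -(label_codeP gK).
Qed.

End ComplexCode.

(** * Radii in increasing order and their labels *)

Section RadiusLabels.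
Variables (R : realType) (d n : nat) (p : set ('rV[R]_d * R)).
Hypothesis card_p : (radii p #= `I_n)%card.

Definition radius_seq (q : set ('rV[R]_d * R)) : seq R :=
  sort (fun x y : R => x <= y) (fset_set (radii q)).

Definition radius_nth (q : set ('rV[R]_d * R)) (j : nat) : R :=
  nth 0 (radius_seq q) j.

Lemma finite_radii : finite_set (radii p).
Proof. by apply/finite_setP; exists n. Qed.

Lemma mem_radius_seq r : reflect (radii p r) (r \in radius_seq p).
Proof.
rewrite mem_sort in_fset_set; last exact: finite_radii.
by apply: (iffP idP); rewrite inE.
Qed.

Lemma size_radius_seq : size (radius_seq p) = n.
Proof. by rewrite size_sort (card_fset_set card_p). Qed.

Lemma radius_label_lt r : radii p r -> (radius_label p r < n)%N.
Proof. by move=> /mem_radius_seq; rewrite -index_mem size_radius_seq. Qed.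

Lemma radius_nthK r : radii p r -> radius_nth p (radius_label p r) = r.
Proof. by move=> /mem_radius_seq; exact: nth_index. Qed.

Lemma radii_nth j : (j < n)%N -> radii p (radius_nth p j).
Proof. by move=> jn; apply/mem_radius_seq; rewrite mem_nth ?size_radius_seq. Qed.

Lemma radius_labelK j : (j < n)%N -> radius_label p (radius_nth p j) = j.
Proof.
move=> jn; apply: index_uniq; first by rewrite -/(radius_seq p) size_radius_seq.
by rewrite sort_uniq fset_uniq.
Qed.

Lemma radius_nth0_le r : radii p r -> radius_nth p 0 <= r.
Proof.
move=> pr; have := radius_label_lt pr; rewrite -{2}(radius_nthK pr) => ln.
apply: (@sorted_leq_nth _ (fun x y : R => x <= y)) => //.
- exact: le_trans.
- by apply: sort_sorted; exact: le_total.
- by rewrite inE size_radius_seq; case: n ln.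
- by rewrite inE size_radius_seq.
Qed.

Lemma radius_nth_gt0 j : sphere_packing p -> (j < n)%N -> 0 < radius_nth p j.
Proof. by move=> [pos _] /radii_nth[A pA <-]; exact: pos. Qed.

End RadiusLabels.

(** * Geometry of canonical triangulations *)

Section Canonical.
Variables (R : realType) (d : nat) (p : set ('rV[R]_d * R)).
Hypothesis cp : compact_packing p.
Implicit Types (A B C : 'rV[R]_d * R) (u v : 'rV[R]_d).

Definition neighbor A B : Prop :=
  p B /\ vertices (link (contact_hypergraph p) A.1) B.1.

Lemma contact_dist (E : {fset 'rV[R]_d}) A B :
  contact_hypergraph p E -> p A -> p B -> A.1 \in E -> B.1 \in E ->
  A.1 != B.1 -> enorm (B.1 - A.1) = A.2 + B.2.
Proof.
move=> [_ _ _ tan _] pA pB AE BE AB; have [sp _ _ _] := cp.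
exact/(tangent_dist sp pA pB AB)/tan.
Qed.

Lemma neighbor_dist A B : p A -> neighbor A B ->
  A.1 != B.1 /\ enorm (B.1 - A.1) = A.2 + B.2.
Proof.
move=> pA [pB [F [KF nAF KAF] BF]].
have AB : A.1 != B.1 by apply: contraNneq nAF => ->.
split=> //; apply: contact_dist KAF _ _ _ _ AB => //; rewrite !inE ?eqxx //.
by rewrite BF orbT.
Qed.

Lemma contact_neighbor A B : p B -> A.1 != B.1 ->
  contact_hypergraph p [fset A.1; B.1]%fset -> neighbor A B.
Proof.
move=> pB AB KAB; split=> //; exists [fset B.1]%fset; last by rewrite inE.
split=> //; last by rewrite inE.
apply: (contact_closed cp KAB); first by apply/fset0Pn; exists B.1; rewrite inE.
by apply/fsubsetP => x; rewrite !inE => ->; rewrite orbT.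
Qed.

Lemma link_neighbor A F v : link (contact_hypergraph p) A.1 F -> v \in F ->
  exists2 B, neighbor A B & B.1 = v.
Proof.
move=> LF vF; have [[_ Fp _ _ _] _ _] := LF; have [B pB Bv] := Fp _ vF.
by exists B => //; split=> //; exists F; rewrite ?Bv.
Qed.

Lemma canonical_vertex A u :
  vertices (@lc_simplices R (canonical_triangulation p A)) u ->
  exists2 B, neighbor A B & u = project A.1 B.1.
Proof.
move=> [_ [F LF <-] /imfsetP[v /= vF ->]].
by have [B AB <-] := link_neighbor LF vF; exists B.
Qed.

Lemma neighbor_vertex A B : neighbor A B ->
  vertices (@lc_simplices R (canonical_triangulation p A)) (project A.1 B.1).
Proof.
move=> [pB [F LF BF]]; exists [fset project A.1 v | v in F]%fset.
  by exists F.
by apply/imfsetP; exists B.1.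
Qed.

Lemma neighbor_label A B : neighbor A B ->
  @lc_labels R (canonical_triangulation p A)
    (project A.1 B.1, radius_label p B.2).
Proof. by move=> [pB AB]; exists B. Qed.

(** The endpoints come from two neighbors lying in a common simplex of the link; these touch, so the
    correction term of [dotr_project] vanishes. *)
Lemma canonical_edge A u v : p A ->
  @edge R (canonical_triangulation p A) u v ->
  exists B C, [/\ neighbor A B, neighbor A C, u = project A.1 B.1,
    v = project A.1 C.1 & dotr u v = cos_contact A.2 B.2 C.2].
Proof.
move=> pA [/= uv [F LF Fuv]].
have lift w : w \in [fset u; v]%fset ->
    exists2 B, neighbor A B /\ B.1 \in F & w = project A.1 B.1.
  rewrite -Fuv => /imfsetP[x /= xF ->].
  by have [B AB Bx] := link_neighbor LF xF; exists B; rewrite Bx.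
have [|B [AB BF] uB] := lift u; first by rewrite !inE eqxx.
have [|C [AC CF] vC] := lift v; first by rewrite !inE eqxx orbT.
exists B, C; split=> //.
have [[pos _] _ _ _] := cp.
have BC : B.1 != C.1 by apply: contraNneq uv => BC; rewrite uB vC BC.
have [KF _ _] := LF.
rewrite uB vC (@dotr_project _ _ A.2 B.2 C.2) ?pos //; try by [case: AB|case: AC].
- rewrite (contact_dist KF) ?subrr ?mul0r ?addr0 //; [by case: AB|by case: AC].
- by have [] := neighbor_dist pA AB.
- by have [] := neighbor_dist pA AC.
Qed.

(** By homogeneity, [A.1] and [B.1] lie in a simplex with [d + 1 >= 3] vertices; any third vertex
    serves as [C]. *)
Lemma neighbor_edge A B : (2 <= d)%N -> p A -> neighbor A B ->
  exists2 C, neighbor A C &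
    @edge R (canonical_triangulation p A) (project A.1 B.1) (project A.1 C.1).
Proof.
move=> d2 pA AB; have [AnB _] := neighbor_dist pA AB.
have [[pos _] [_ _ _] homog _] := cp.
have [pB [F [_ _ KAF] BF]] := AB.
have [E [KE AFE cardE]] := homog _ KAF.
have AE : A.1 \in E by apply: (fsubsetP AFE); rewrite !inE eqxx.
have BE : B.1 \in E by apply: (fsubsetP AFE); rewrite !inE BF orbT.
have : (E `\` [fset A.1; B.1] != fset0)%fset.
  rewrite -cardfs_gt0 cardfsD cardE subn_gt0.
  apply: leq_ltn_trans (fsubset_leq_card (fsubsetIr _ _)) _.
  by rewrite cardfs2 ltnS (leq_trans _ d2) // ltnS leq_b1.
move=> /fset0Pn[c]; rewrite !inE negb_or => /andP[/andP[cA cB] cE].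
have [_ Ep _ _ _] := KE; have [C pC Cc] := Ep c cE.
rewrite -Cc in cA cB cE.
have LBC : link (contact_hypergraph p) A.1 [fset B.1; C.1]%fset.
  have sub : (A.1 |` [fset B.1; C.1] `<=` E)%fset.
    by apply/fsubsetP => x; rewrite !inE => /or3P[]/eqP->.
  split.
  - apply: (contact_closed cp KE).
      by apply/fset0Pn; exists B.1; rewrite !inE eqxx.
    by apply: fsubset_trans sub; exact: fsubsetU1.
  - by rewrite !inE negb_or AnB eq_sym.
  - apply: (contact_closed cp KE) => //.
    by apply/fset0Pn; exists A.1; rewrite !inE eqxx.
have AC : neighbor A C.
  by split=> //; exists [fset B.1; C.1]%fset; rewrite // !inE eqxx orbT.
exists C => //; split => /=; last first.
  exists [fset B.1; C.1]%fset => //.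
  apply/fsetP => x; apply/imfsetP/idP => [[y /=]|].
    by rewrite !inE => /orP[]/eqP-> ->; rewrite eqxx ?orbT.
  by rewrite !inE => /orP[]/eqP->; [exists B.1|exists C.1] => //=;
     rewrite !inE eqxx ?orbT.
have [_ dAB] := neighbor_dist pA AB; have [_ dAC] := neighbor_dist pA AC.
(* Coinciding projections would have inner product 1, but the cosine of a contact angle is less than
   1. *)
apply/eqP => same.
have := @dotr_project _ _ _ _ _ _ _ _ (pos _ pA) (pos _ pB) (pos _ pC) dAB dAC.
rewrite (contact_dist KE pB pC) ?subrr ?mul0r ?addr0 //; last by rewrite eq_sym.
rewrite -same dotr_unit_normalize; last by rewrite dAB gt_eqF ?addr_gt0 ?pos.
have /andP[_] := cos_contact_itv (pos _ pA) (pos _ pB) (pos _ pC).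
by move=> /[swap] <-; rewrite ltxx.
Qed.

(** The size bound on [A] makes both shares at least [(r + 1)^-1], and disjointness of the two
    neighbors makes the correction term of [dotr_project] nonpositive. *)
Lemma dotr_neighbors_le (r : R) A B C : 0 < r -> p A ->
  (forall D, p D -> A.2 <= r * D.2) ->
  neighbor A B -> neighbor A C -> B.1 != C.1 ->
  dotr (project A.1 B.1) (project A.1 C.1) <= 1 - 2 * (r + 1)^-1 ^+ 2.
Proof.
move=> r0 pA small AB AC BC; have [sp _ _ _] := cp; have [pos _] := sp.
have A0 := pos _ pA; have pB := AB.1; have pC := AC.1.
have B0 := pos _ pB; have C0 := pos _ pC.
rewrite (@dotr_project _ _ A.2 B.2 C.2) //.
- have shareD D : p D -> (r + 1)^-1 <= share A.2 D.2.
    move=> pD; have D0 := pos _ pD; rewrite /share ler_pdivlMr ?addr_gt0 //.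
    rewrite mulrC ler_pdivrMr ?addr_gt0 // mulrDr mulr1 mulrC lerD2r.
    exact: small.
  have : (r + 1)^-1 ^+ 2 <= share A.2 B.2 * share A.2 C.2.
    by rewrite expr2 ler_pM ?shareD // invr_ge0 addr_ge0 ?ltW.
  suff : ((B.2 + C.2) ^+ 2 - enorm (C.1 - B.1) ^+ 2) /
         (2 * (A.2 + B.2) * (A.2 + C.2)) <= 0 by rewrite /cos_contact; lra.
  rewrite pmulr_lle0 ?invr_gt0 ?mulr_gt0 ?addr_gt0 // subr_le0.
  rewrite ler_pXn2r ?nnegrE ?enorm_ge0 ?addr_ge0 ?(ltW B0) ?(ltW C0) //.
  exact: (packing_dist_ge sp).
- by have [] := neighbor_dist pA AB.
- by have [] := neighbor_dist pA AC.
Qed.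

Lemma canonical_label_lt n A v l : (radii p #= `I_n)%card ->
  @lc_labels R (canonical_triangulation p A) (v, l) -> (l < n)%N.
Proof.
by move=> card_p [B [pB _] [_ <-]]; apply: (radius_label_lt card_p); exists B.
Qed.

End Canonical.

(** * Monotonicity of the arc cosine and of products *)

Lemma ltr_acos (R : realType) :
  {in `[-1, 1] &, {mono (@acos R) : x y /~ y < x}}.
Proof.
move=> x y x1 y1; have itv z : z \in `[-1, 1] -> acos z \in `[0 : R, pi].
  by rewrite !in_itv /= => z1; rewrite acos_ge0 // acos_lepi.
by rewrite -(ltr_cos (itv _ y1) (itv _ x1)) !acosK.
Qed.

Lemma mulr_eq_le (R : realDomainType) (x y x' y' : R) :
  0 < x -> 0 < y -> x <= x' -> y <= y' -> x' * y' = x * y -> x' <= x.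
Proof.
move=> x0 y0 xx' yy' e; rewrite leNgt; apply/negP => lt.
have : x * y < x' * y'.
  apply: (@lt_le_trans _ _ (x' * y)); first by rewrite ltr_pM2r.
  by rewrite ler_wpM2l // (le_trans (ltW x0)).
by rewrite e ltxx.
Qed.

(** * Comparison of two packings associated to [S] *)

Section Main.
Variables (R : realType) (d n : nat) (S : set (labeled_complex R)).
Hypothesis d2 : (2 <= d)%N.
Hypothesis sub_S : S `<=` @labeled_triangulations R.
Hypothesis hS : heteroperturbative S.

Lemma label_isomorphism_id (P : labeled_complex R) : @label_isomorphism R P P id.
Proof.
split=> //; split; first by split=> // v Kv; exists v.
by move=> E _; rewrite (_ : [fset id v | v in E]%fset = E) // imfset_id.
Qed.

(** Functionality of the labeling is part of being a labeled triangulation, so it follows from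
    membership in [S]. *)
Lemma canonical_label_uniq (p : set ('rV[R]_d * R)) A u l l' :
  associated p S -> p A ->
  vertices (@lc_simplices R (canonical_triangulation p A)) u ->
  @lc_labels R (canonical_triangulation p A) (u, l) ->
  @lc_labels R (canonical_triangulation p A) (u, l') -> l = l'.
Proof.
move=> Sp pA Ku ul ul'; have [_ _ _ /(_ u Ku)[k [_ kE]]] := sub_S (Sp _ pA).
by rewrite -(kE _ ul) -(kE _ ul').
Qed.

Lemma eq_class_canonical (p q : set ('rV[R]_d * R)) A B
    (phi : 'rV[R]_d -> 'rV[R]_d) :
  associated q S -> q B ->
  @label_isomorphism R (canonical_triangulation p A)
                       (canonical_triangulation q B) phi ->
  radius_label p A.2 = radius_label q B.2 ->
  eq_class (canonical_triangulation p A) (canonical_triangulation q B).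
Proof.
by move=> Sq qB iso lAB; split; [exact/sub_S/Sq|split=> //; exists phi].
Qed.

Section TwoPackings.
Variables (p q : set ('rV[R]_d * R)).
Hypothesis (cp : compact_packing p) (cq : compact_packing q).
Hypothesis (card_p : (radii p #= `I_n)%card) (card_q : (radii q #= `I_n)%card).
Hypothesis (Sp : associated p S) (Sq : associated q S).

Lemma canonical_edge_iso A A' (phi : 'rV[R]_d -> 'rV[R]_d) (u v : 'rV[R]_d) :
  p A -> q A' ->
  @label_isomorphism R (canonical_triangulation p A)
                       (canonical_triangulation q A') phi ->
  @edge R (canonical_triangulation p A) u v ->
  @edge R (canonical_triangulation q A') (phi u) (phi v).
Proof.
move=> pA qA' [[[_ inj _] iso] _] [uv Kuv].
have Ku : vertices (@lc_simplices R (canonical_triangulation p A)) u.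
  by exists [fset u; v]%fset; rewrite // !inE eqxx.
have Kv : vertices (@lc_simplices R (canonical_triangulation p A)) v.
  by exists [fset u; v]%fset; rewrite // !inE eqxx orbT.
split; first by apply: contraNneq uv => /inj->//; rewrite inE.
have -> : [fset phi u; phi v]%fset = [fset phi w | w in [fset u; v]]%fset.
  apply/fsetP => x; apply/idP/imfsetP => [|[y /=]].
    by rewrite !inE => /orP[]/eqP->; [exists u|exists v] => //=;
       rewrite !inE eqxx ?orbT.
  by rewrite !inE => /orP[]/eqP-> ->; rewrite eqxx ?orbT.
by apply/iso => // w /=; rewrite !inE => /orP[]/eqP->.
Qed.

(* If the ratios [r_j / r_i] do not decrease from [p] to [q], then neither do the
   edge lengths of the triangulations at label [i], so heteroperturbativity
   forces them, and hence these ratios, to be constant. *)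
Lemma rigid_neighbors A A' (phi : 'rV[R]_d -> 'rV[R]_d) B : p A -> q A' ->
  radius_label p A.2 = radius_label q A'.2 ->
  @label_isomorphism R (canonical_triangulation p A)
                       (canonical_triangulation q A') phi ->
  (forall j, (j < n)%N -> A'.2 * radius_nth p j <= A.2 * radius_nth q j) ->
  neighbor p A B ->
  A'.2 * B.2 = A.2 * radius_nth q (radius_label p B.2).
Proof.
move=> pA qA' lA iso mono AB; have [[[posp _] _ _ _] [[posq _] _ _ _]] := (cp, cq).
have A0 := posp _ pA; have A'0 := posq _ qA'.
(* [r' C] is the radius in [q] of the label that [C] carries in [p]. *)
pose r' (C : 'rV[R]_d * R) := radius_nth q (radius_label p C.2).
have lt_label C : p C -> (radius_label p C.2 < n)%N.
  by move=> pC; apply: (radius_label_lt card_p); exists C.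
have r'_gt0 C : p C -> 0 < r' C.
  by move=> /lt_label ln; apply: (radius_nth_gt0 card_q) => //; case: cq.
have mono_share C : p C -> share A.2 C.2 <= share A'.2 (r' C).
  move=> pC; rewrite ler_share // ?posp ?r'_gt0 //.
  rewrite -{1}(radius_nthK card_p (r := C.2)); last by exists C.
  exact/mono/lt_label.
have edge_dots (u v : 'rV[R]_d) :
  @edge R (canonical_triangulation p A) u v -> exists B C,
    [/\ neighbor p A B, neighbor p A C, u = project A.1 B.1, v = project A.1 C.1 &
        dotr u v = cos_contact A.2 B.2 C.2 /\
        dotr (phi u) (phi v) = cos_contact A'.2 (r' B) (r' C)].
  move=> uv; have [C [D [AC AD uE vE uvE]]] := canonical_edge cp pA uv.
  have [C' [D' [AC' AD' uE' vE' uvE']]] :=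
    canonical_edge cq qA' (canonical_edge_iso pA qA' iso uv).
  exists C, D; split=> //; split=> //; rewrite uvE'.
  have r'E w (E E' : 'rV[R]_d * R) : neighbor p A E -> neighbor q A' E' ->
      w = project A.1 E.1 -> phi w = project A'.1 E'.1 -> E'.2 = r' E.
    move=> AE AE' wE wE'.
    rewrite -(radius_nthK card_q (r := E'.2)); last by exists E' => //; case: AE'.
    congr (radius_nth q _).
    apply: (canonical_label_uniq (u := phi w) Sq qA') => //.
    - by rewrite wE'; exact: neighbor_vertex.
    - by rewrite wE'; exact: neighbor_label.
    - apply/(iso.2 w); first by rewrite wE; exact: neighbor_vertex.
      by rewrite wE; exact: neighbor_label.
  by rewrite (r'E u C C') // (r'E v D D').
have itv a b c : 0 < a -> 0 < b -> 0 < c -> cos_contact a b c \in `[-1, 1 : R].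
  move=> a0 b0 c0; rewrite in_itv /=.
  by have /andP[/ltW-> /ltW->] := cos_contact_itv a0 b0 c0.
have [isom|nisom] := pselect (edge_isometric (P := canonical_triangulation p A)
    (Q := canonical_triangulation q A') phi); last first.
  (* Without isometry some edge would get strictly shorter from [p] to [q]; but no share decreases,
     so no cosine increases. *)
  have PP : eq_class (canonical_triangulation p A) (canonical_triangulation p A).
    apply: (eq_class_canonical (phi := id) Sp) => //.
    exact: label_isomorphism_id.
  have PQ := eq_class_canonical Sq qA' iso lA.
  have [[u [v [uv uv_lt]]] _] :=
    hS (Sp pA) (conj PP (Sp pA)) (conj PQ (Sq qA')) iso nisom.
  have [C [D [[pC _] [pD _] _ _ [e1 e2]]]] := edge_dots _ _ uv.
  have := uv_lt : acos (@dotr R d (phi u) (phi v)) < acos (@dotr R d u v).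
  rewrite e1 e2 ltr_acos ?itv // ?r'_gt0 ?posp //.
  rewrite ltNge => /negP[]; rewrite /cos_contact lerD2l lerN2 ler_pM2l //.
  by rewrite ler_pM ?mono_share // ltW // share_gt0 // posp.
have [C AC BC] := neighbor_edge cp d2 pA AB.
have [B' [C' [AB' AC' BB' _ [e1 e2]]]] := edge_dots _ _ BC.
have [pB _] := AB; have [pB' _] := AB'; have [pC' _] := AC'.
(* [B'] is only known to have the same projection as [B]; uniqueness of labels gives equal radii. *)
have -> : B.2 = B'.2.
  rewrite -(radius_nthK card_p (r := B.2)); last by exists B.
  rewrite -(radius_nthK card_p (r := B'.2)); last by exists B'.
  congr (radius_nth p _).
  apply: (canonical_label_uniq (u := project A.1 B.1) Sp pA) => //.
  - exact: neighbor_vertex.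
  - exact: neighbor_label.
  - by rewrite BB'; exact: neighbor_label.
have := isom _ _ BC : acos (@dotr R d _ _) = acos (@dotr R d _ _).
rewrite e1 e2 => /(congr1 cos).
rewrite !acosK ?itv // ?r'_gt0 ?posp // => cosE.
have sB := mono_share _ pB'; have sC := mono_share _ pC'.
have sB0 := share_gt0 A0 (posp _ pB'); have sC0 := share_gt0 A0 (posp _ pC').
(* The product of two shares is unchanged while neither factor decreases, so each factor is
   unchanged. *)
have : share A'.2 (r' B') <= share A.2 B'.2.
  have nz2 : 2 != 0 :> R by rewrite pnatr_eq0.
  by move/addrI/oppr_inj/(mulfI nz2)/esym: cosE; apply: mulr_eq_le.
rewrite ler_share // ?posp ?r'_gt0 // => le1; apply/eqP; rewrite eq_le.
by move: sB; rewrite ler_share // ?posp ?r'_gt0 // => ->.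
Qed.


End TwoPackings.
(** [insub] puts the center label into a finite type; it never yields [None] for a sphere of a
    packing with [n] radii. *)
Definition triangulation_code (G : finType) (g : 'rV[R]_d -> G)
    (p : set ('rV[R]_d * R)) (A : 'rV[R]_d * R) :
    {set {set G}} * {set G * 'I_n} * option 'I_n :=
  let P := canonical_triangulation p A in
  (scheme_code g (@lc_simplices R P),
   label_code n g (@lc_simplices R P) (@lc_labels R P), insub (lc_center_label P)).

Definition realizes (G : finType) (g : 'rV[R]_d -> G) (p : set ('rV[R]_d * R))
    (M : {set 'I_n}) (c : {set {set G}} * {set G * 'I_n} * option 'I_n) : Prop :=
  exists A B (i j : 'I_n),
    [/\ p A /\ neighbor p A B, i \in M /\ A.2 = radius_nth p i,
        j \notin M /\ B.2 = radius_nth p j,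
        set_inj (vertices (@lc_simplices R (canonical_triangulation p A))) g
      & c = triangulation_code g p A].

(** Connectedness gives a sphere [A] labeled in [M] with a neighbor labeled outside. As [A] is at
    most [r] times as large as any sphere, [g] tells its neighbors apart. *)
Lemma realizes_exists (G : finType) (g : 'rV[R]_d -> G) (r : R) p
    (M : {set 'I_n}) :
  compact_packing p -> (radii p #= `I_n)%card -> 0 < r ->
  (forall u v, enorm u = 1 -> enorm v = 1 ->
     dotr u v <= 1 - 2 * (r + 1)^-1 ^+ 2 -> g u != g v) ->
  M != finset.set0 -> M != [set: 'I_n]%SET ->
  (forall i, i \in M -> radius_nth p i <= r * radius_nth p 0) ->
  exists c, realizes g p M c.
Proof.
move=> cp card_p r0 g_sep /set0Pn[i iM] MT small.
have [j jM] : exists j, j \notin M.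
  apply: contrapT => all_in; case/eqP: MT; apply/setP => j; rewrite !inE.
  by apply: contrapT => /negP jM; apply: all_in; exists j.
have [sp _ _ _] := cp; have [pos _] := sp.
have nth_inM k : (exists2 i : 'I_n, i \in M & radius_nth p i = radius_nth p k) ->
    forall kn : (k < n)%N, Ordinal kn \in M.
  move=> [l lM lk] kn; have := radius_labelK card_p kn.
  rewrite -lk (radius_labelK card_p (ltn_ord l)) => lkE.
  by rewrite (_ : Ordinal kn = l) //; apply: val_inj.
have [||A [B [pA pB [k kM Ak] nB KAB]]] := @contact_crossing _ _ _ cp
    [set x | exists2 i : 'I_n, i \in M & radius_nth p i = x].
- by exists (radius_nth p i); split; [exact: (radii_nth card_p)|exists i].
- exists (radius_nth p j); split; first exact: (radii_nth card_p).
  move=> /nth_inM/(_ (ltn_ord j)).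
  by rewrite (_ : Ordinal _ = j) ?(negbTE jM) //; exact: val_inj.
have AB : A.1 != B.1.
  apply/eqP => AB; apply: nB; exists k => //; rewrite Ak.
  by rewrite (packing_center_inj sp pA pB AB).
have pB2 : radii p B.2 by exists B.
exists (triangulation_code g p A), A, B, k, (Ordinal (radius_label_lt card_p pB2)).
split=> //.
- by split=> //; exact: contact_neighbor.
- split; last by rewrite (radius_nthK card_p).
  apply/negP => BM; apply: nB; exists (Ordinal (radius_label_lt card_p pB2)) => //.
  exact: (radius_nthK card_p).
have small_A D : p D -> A.2 <= r * D.2.
  move=> pD; rewrite -Ak (le_trans (small _ kM)) // ler_pM2l //.
  by apply: (radius_nth0_le card_p); exists D.
move=> u v; rewrite !inE => /canonical_vertex[C AC ->] /canonical_vertex[D AD ->] gCD.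
have [->//|CD] := eqVneq C.1 D.1.
have unit E : neighbor p A E -> enorm (project A.1 E.1) = 1.
  move=> AE; have [_ dE] := neighbor_dist cp pA AE.
  have E0 : 0 < enorm (E.1 - A.1) by rewrite dE addr_gt0 ?pos //; case: AE.
  by rewrite enormZ normfV gtr0_norm // mulVf // gt_eqF.
have := g_sep _ _ (unit _ AC) (unit _ AD) (dotr_neighbors_le cp r0 pA small_A AC AD CD).
by rewrite gCD eqxx.
Qed.

(* [M] is the set of labels [i] minimizing [radius_nth q i / radius_nth p i]. *)
Lemma minimal_ratio_not_realized (G : finType) (g : 'rV[R]_d -> G) p q
    (M : {set 'I_n}) c :
  compact_packing p -> compact_packing q ->
  (radii p #= `I_n)%card -> (radii q #= `I_n)%card ->
  associated p S -> associated q S ->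
  (forall i : 'I_n, i \in M <-> forall j : 'I_n,
     radius_nth q i * radius_nth p j <= radius_nth p i * radius_nth q j) ->
  realizes g p M c -> realizes g q M c -> False.
Proof.
move=> cp cq card_p card_q Sp Sq ME [A [B [i [j]]]].
move=> [[pA AB] [iM Ai] [jM Bj] gA cE] [A' [_ [i' [_ [[qA' _] [_ A'i'] _ gA' c'E]]]]].
move: c'E; rewrite cE => -[eqK eql eqc].
have [pA2 qA'2] : radii p A.2 /\ radii q A'.2 by split; [exists A|exists A'].
have lA : radius_label p A.2 = radius_label q A'.2.
  move: eqc; rewrite (insubT (fun k => (k < n)%N) (radius_label_lt card_p pA2)).
  rewrite (insubT (fun k => (k < n)%N) (radius_label_lt card_q qA'2)).
  by case.
have [phi iso] := code_isomorphism gA gA'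
  (fun v l => canonical_label_lt card_p) (fun v l => canonical_label_lt card_q) eqK eql.
(* The codes include the center label, so [A'] carries the same label [i] as [A]. *)
have A'2 : A'.2 = radius_nth q i.
  by rewrite -(radius_nthK card_q qA'2) -lA Ai (radius_labelK card_p).
have := rigid_neighbors cp cq card_p card_q Sp Sq pA qA' lA iso _ AB.
rewrite Bj (radius_labelK card_p) // A'2 Ai => rigid.
(* By [rigid], label [j] has the same ratio as the minimizer [i], so [j] would lie in [M]. *)
case/negP: jM; apply/ME => k; have sp : sphere_packing p by case: cp.
have mono := (ME i).1 iM.
rewrite -(ler_pM2l (radius_nth_gt0 card_p sp (ltn_ord i))) mulrA -rigid; last first.
  by move=> l ln; have := mono (Ordinal ln).
by rewrite mulrAC [leRHS]mulrCA [leLHS]mulrC ler_pM2l // (radius_nth_gt0 card_p sp).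
Qed.
End Main.

(** * Subfamilies and the finiteness theorem *)

(** Induction on the number of labels: if some sublevel set of the new ratio within [W] is infinite,
    [W] shrinks to it; otherwise the ratio diverges along [W]. Earlier alternatives survive the
    passage to a subset. *)
Lemma bounded_or_divergent (R : realType) (t : nat -> nat -> R) (n : nat) :
  exists (W : set nat) (I : pred nat) (b : R), infinite_set W /\
    forall j, (j < n)%N ->
      (I j -> forall m, W m -> t m j <= b) /\
      (~~ I j -> forall c, finite_set [set m | W m /\ t m j <= c]).
Proof.
elim: n => [|n [W [I [b [Winf WI]]]]].
  by exists setT, predT, 0; split=> //; exact: infinite_nat.
have [[c cinf]|none] := pselect (exists c, infinite_set [set m | W m /\ t m n <= c]).
  exists [set m | W m /\ t m n <= c], [pred j | (j == n) || I j], (Num.max b c).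
  split=> // j; rewrite ltnS leq_eqVlt /= => /orP[/eqP->|jn].
    by rewrite eqxx /=; split=> // _ m [_ le_c]; rewrite le_max le_c orbT.
  rewrite (ltn_eqF jn) /=; have [Ij nIj] := WI _ jn; split.
    by move=> /Ij bnd m [/bnd le_b _]; rewrite le_max le_b.
  move=> /nIj fin c'; apply: sub_finite_set (fin c').
  by move=> m [[Wm _] le_c].
exists W, [pred j | (j != n) && I j], b; split=> // j.
rewrite ltnS leq_eqVlt /= => /orP[/eqP->|jn]; last first.
  by rewrite (ltn_eqF jn) /=; exact: WI.
rewrite eqxx /=; split=> // _ c; apply: contrapT => cinf; apply: none.
by exists c.
Qed.

Lemma infinite_pigeonhole (T : finType) (F : nat -> T) (W : set nat) :
  infinite_set W -> exists c, infinite_set [set m | W m /\ F m = c].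
Proof.
move=> Winf; apply: contrapT => none; apply: Winf.
have -> : W = \bigcup_(c in [set: T]) [set m | W m /\ F m = c].
  by apply/seteqP; split=> [m Wm|m [c _ []]] //; exists (F m).
apply: bigcup_finite => // c _; apply: contrapT => cinf; apply: none.
by exists c.
Qed.

Lemma scaled_radii_eq (R : realType) (d n : nat) (p q : set ('rV[R]_d * R)) (c : R) :
  (radii p #= `I_n)%card -> (radii q #= `I_n)%card -> 0 < c ->
  (forall j, (j < n)%N -> radius_nth q j = c * radius_nth p j) ->
  radii p 1 -> ubound (radii p) 1 -> radii q 1 -> ubound (radii q) 1 ->
  radii p = radii q.
Proof.
move=> card_p card_q c0 qp p1 pub q1 qub.
have [jp jq] := (radius_label_lt card_p p1, radius_label_lt card_q q1).
(* At the label of 1 in [p], the radius of [q] is [c <= 1]; at the label of 1 in [q], 1 is [c] times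
   a radius of [p], so [1 <= c]. *)
have c1 : c = 1.
  apply/eqP; rewrite eq_le.
  have := qub _ (radii_nth card_q jp).
  rewrite qp // (radius_nthK card_p) // mulr1 => -> /=.
  have := radius_nthK card_q q1; rewrite qp // => <-.
  by rewrite -[leRHS]mulr1 ler_pM2l //; apply/pub/(radii_nth card_p).
have nthE j : (j < n)%N -> radius_nth q j = radius_nth p j.
  by move=> /qp->; rewrite c1 mul1r.
apply/seteqP; split=> r rr.
  have ln := radius_label_lt card_p rr.
  by rewrite -(radius_nthK card_p rr) -nthE //; exact: (radii_nth card_q).
have ln := radius_label_lt card_q rr.
by rewrite -(radius_nthK card_q rr) nthE //; exact: (radii_nth card_p).
Qed.

Theorem theorem1p2 (R : realType) (d n : nat) (hd : (2 <= d)%N) (hn : (2 <= n)%N)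
  (S : set (labeled_complex R)) (hST : (S `<=` @labeled_triangulations R)%classic)
  (hS : heteroperturbative S) : finite_set (@Pi_radii R d n S).
Proof.
(* An infinite set of radii sets admits an injection [f] from [nat]; [p m] is then a packing with
   radii set [f m]. *)
apply: contrapT => /infiniteP/pcard_leP/unsquash f.
have n0 : (0 < n)%N by apply: leq_trans hn.
have /choice[p pP] : forall m, exists p : set ('rV[R]_d * R),
    [/\ compact_packing p, associated p S, (radii p #= `I_n)%card,
        radii p 1 & ubound (radii p) 1] /\ radii p = f m.
  move=> m; have [p Pp pf] : @Pi_radii R d n S (f m) by exact: funS.
  by exists p.
have p_inj m m' : radii (p m) = radii (p m') -> m = m'.
  by rewrite (pP m).2 (pP m').2; apply: (@inj _ _ _ f); rewrite in_setT.
have cp m : compact_packing (p m) by case: (pP m) => [[]].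
have Sp m : associated (p m) S by case: (pP m) => [[]].
have card_p m : (radii (p m) #= `I_n)%card by case: (pP m) => [[]].
have p1 m : radii (p m) 1 by case: (pP m) => [[]].
have pub m : ubound (radii (p m)) 1 by case: (pP m) => [[]].
pose r m j := radius_nth (p m) j.
have r0 m j : (j < n)%N -> 0 < r m j.
  by apply: (radius_nth_gt0 (card_p m)); case: (cp m).
have [W [I [b [Winf WI]]]] := bounded_or_divergent (fun m j => r m j / r m 0%N) n.
(* The maximum with 1 only ensures positivity. *)
pose b' := Num.max b 1.
have b'0 : 0 < b' by rewrite lt_max ltr01 orbT.
have delta0 : 0 < 2 * (b' + 1)^-1 ^+ 2.
  by rewrite mulr_gt0 // exprn_gt0 // invr_gt0 addr_gt0.
have [G [g g_sep]] := separating_grid d delta0.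
pose small (M : {set 'I_n}) :=
  [/\ M != finset.set0, M != [set: 'I_n]%SET & forall i, i \in M -> I i].
(* [F] fixes a code for every small [M] at once, because the set [M] used below depends on the pair
   of packings chosen after the pigeonhole. *)
have /choice[F FP] : forall m, exists
    F : {ffun {set 'I_n} -> {set {set G}} * {set G * 'I_n} * option 'I_n},
    W m -> forall M, small M -> realizes g (p m) M (F M).
  move=> m; have : forall M, exists c, W m -> small M -> realizes g (p m) M c.
    move=> M; have [[Wm [M0 MT MI]]|not_small] := pselect (W m /\ small M).
      have [|c] := @realizes_exists _ _ _ _ g b' (p m) M
        (cp m) (card_p m) b'0 g_sep M0 MT.
        move=> i iM; rewrite -ler_pdivrMr; last exact: r0.
        by rewrite le_max ((WI i (ltn_ord i)).1 (MI _ iM)).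
      by move=> rc; exists c.
    by exists (finset.set0, finset.set0, None) => ? ?; case: not_small.
  move=> /choice[F FP]; exists [ffun M => F M] => Wm M sM.
  by rewrite ffunE; exact: FP.
have [c Winf'] := infinite_pigeonhole F Winf.
have [m [Wm Fm]] := infinite_setN0 Winf'.
(* All but finitely many indices qualify: besides [m], each divergent label excludes a finite
   set. *)
have [m' [[[Wm' Fm'] late_m'] mm']] : exists m', (([set m' | W m' /\ F m' = c] m' /\
    forall j : 'I_n, ~~ I j -> r m j / r m 0%N < r m' j / r m' 0%N) /\ m' <> m).
  apply: contrapT => none; apply: Winf'.
  apply: (@sub_finite_set _ _ ([set m] `|` \bigcup_(j in [set j : 'I_n | ~~ I j])
     [set m' | W m' /\ r m' j / r m' 0%N <= r m j / r m 0%N])).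
    move=> m' [Wm' Fm']; have [->|mm'] := pselect (m' = m); first by left.
    right; apply: contrapT => nj; apply: none; exists m'; split=> //; split=> // j Ij.
    by rewrite ltNge; apply/negP => le_j; apply: nj; exists j.
  rewrite finite_setU; split; first exact: finite_set1.
  apply: bigcup_finite; first exact: finite_finset.
  by move=> j Ij; have := (WI j (ltn_ord j)).2 Ij.
pose M := [set i : 'I_n | [forall j : 'I_n, r m' i * r m j <= r m i * r m' j]]%SET.
have ME (i : 'I_n) : i \in M <-> forall j : 'I_n, r m' i * r m j <= r m i * r m' j.
  by rewrite inE; split=> [/forallP|/forallP].
(* If every label minimizes the ratio, the radii are proportional, hence equal, and injectivity
   gives [m = m']. *)
have [MT|MT] := eqVneq M [set: 'I_n]%SET.
  apply: mm'; apply/esym/p_inj.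
  apply: (@scaled_radii_eq _ _ n _ _ (r m' 0%N / r m 0%N)) => //.
    by rewrite divr_gt0 ?r0.
  move=> j jn; have all_M (i : 'I_n) : i \in M by rewrite MT inE.
  have := (ME _).1 (all_M (Ordinal jn)) (Ordinal n0).
  have := (ME _).1 (all_M (Ordinal n0)) (Ordinal jn) => /= le1 le2.
  have nz : r m 0%N != 0 by rewrite gt_eqF ?r0.
  apply: (mulIf nz); rewrite [RHS]mulrAC divfK //; apply/eqP.
  by rewrite eq_le; apply/andP; split; rewrite [leRHS]mulrC.
have M0 : M != finset.set0.
  have [i _ iE] :=
    @arg_minP _ _ _ (Ordinal n0) predT (fun i : 'I_n => r m' i / r m i) isT.
  apply/set0Pn; exists i; apply/ME => j.
  have := iE j isT; rewrite ler_pdivrMr ?r0 // mulrAC ler_pdivlMr ?r0 //.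
  by rewrite (mulrC (r m i)).
(* Compared with label 0, a divergent label has strictly gained from [m] to [m'], so it is no
   minimizer. *)
have MI i : i \in M -> I i.
  move=> /ME/(_ (Ordinal n0)) /= le_i; apply: contrapT => /negP/late_m'.
  rewrite ltr_pdivrMr ?r0 // mulrAC ltr_pdivlMr ?r0 //.
  by rewrite ltNge le_i.
have sM : small M by [].
apply: (minimal_ratio_not_realized hd hST hS (cp m) (cp m') (card_p m) (card_p m')
  (Sp m) (Sp m') ME (FP m Wm M sM)).
by rewrite Fm -Fm'; exact: FP.
Qed.
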